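(* The family of binary delta-matroids is vf-closed, i.e., if $M$ is a binary delta-matroid and $\rho$ is an invertible vertex flip on an element of its ground set, then $M\rho$ is a binary delta-matroid. In particular, every binary delta-matroid is vf-safe.
   Context: A set system is a pair $M=(V,D)$ with $V$ a finite set (the ground set) and $D$ a family of subsets of $V$; it is proper if $D\neq\varnothing$. We write $Y\in M$ for $Y\in D$. $\triangle$ denotes symmetric difference. A delta-matroid is a proper set system $M$ satisfying the symmetric exchange axiom: for all $X,Y\in M$ and all $u\in X\triangle Y$, either $X\triangle\{u\}\in M$ or there is a $w\in X\triangle Y$ with $w\neq u$ such that $X\triangle\{u,w\}\in M$. For $X\subseteq V$, the pivot of $M$ on $X$ is $M*X=(V,\{Y\triangle X\mid Y\in D\})$; for $v\in V$, $M*v=M*\{v\}$, and the loop complementation of $M$ on $v$ is $M+v=(V,D\triangle\{Z\cup\{v\}\mid Z\in D,\ v\notin Z\})$. The operations $*v$ and $+v$ are involutions generating a group of order $6$ (isomorphic to $S_3$) of operations on set systems over $V$; these six operations (including the identity) are the invertible vertex flips on $v$. Operations are applied from left to right. For a $V\times V$ matrix $A$ over a field, $\mathcal{M}_A=(V,\{X\subseteq V\mid A[X]\text{ is nonsingular}\})$, where $A[X]$ is the principal submatrix of $A$ on $X$ and the empty matrix is nonsingular by convention. A delta-matroid $M$ is representable over a field $\mathbb{F}$ if $M=\mathcal{M}_A*X$ for some skew-symmetric $V\times V$ matrix $A$ over $\mathbb{F}$ (i.e., $A^T=-A$; nonzero diagonal entries are allowed in characteristic $2$) and some $X\subseteq V$.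 A delta-matroid is binary if it is representable over $\mathbb{F}_2$ (so $A$ is any symmetric matrix over $\mathbb{F}_2$). A family of delta-matroids is vf-closed if it is closed under invertible vertex flips. A delta-matroid $M$ is vf-safe (vertex-flip-safe) if for any sequence $\varphi$ of invertible vertex flips (equivalently, of pivots and loop complementations) on elements of $V$, $M\varphi$ is a delta-matroid. *)

(* Defs.v *)
From Stdlib Require List.
From mathcomp Require Import all_boot all_algebra.
Set Implicit Arguments.
Unset Strict Implicit.
Unset Printing Implicit Defensive.

Local Open Scope ring_scope.

(* The ground set is the whole type V; a set system on it is its family D. *)
Definition set_system (V : finType) : Type := {set {set V}}.

Definition symdiff (T : finType) (A B : {set T}) : {set T} :=
  (A :\: B) :|: (B :\: A).

Definition proper_system (V : finType) (M : set_system V) : Prop :=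
  M != set0.

Definition symmetric_exchange (V : finType) (M : set_system V) : Prop :=
  forall X Y : {set V}, X \in M -> Y \in M ->
  forall u : V, u \in symdiff X Y ->
    symdiff X [set u] \in M \/
    exists w : V, [/\ w \in symdiff X Y, w != u & symdiff X [set u; w] \in M].

Definition delta_matroid (V : finType) (M : set_system V) : Prop :=
  proper_system M /\ symmetric_exchange M.

Definition pivot (V : finType) (X : {set V}) (M : set_system V) :
    set_system V :=
  [set symdiff Y X | Y in M].

Definition loop_compl (V : finType) (v : V) (M : set_system V) :
    set_system V :=
  symdiff M [set v |: Z | Z : {set V} in M & v \notin Z].

(* The group generated by pivot and loop complementation on v. Both generators
   are involutions, so closing under composition already gives inverses. *)
Inductive invertible_vertex_flip (V : finType) (v : V) :
    (set_system V -> set_system V) -> Prop :=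
| flip_id : invertible_vertex_flip v (fun M => M)
| flip_pivot rho : invertible_vertex_flip v rho ->
    invertible_vertex_flip v (fun M => pivot [set v] (rho M))
| flip_loop_compl rho : invertible_vertex_flip v rho ->
    invertible_vertex_flip v (fun M => loop_compl v (rho M)).

(* A V x V matrix is a square matrix of order #|V|, with rows and columns
   labelled by V through enum_rank. *)
Definition principal_submx (F : fieldType) (V : finType) (A : 'M[F]_#|V|)
    (X : {set V}) : 'M[F]_#|X| :=
  let label (i : 'I_#|X|) := enum_rank (enum_val i : V) in
  mxsub label label A.

(* For X = set0 the submatrix is 0 x 0, with determinant 1, hence in unitmx. *)
Definition matrix_system (F : fieldType) (V : finType) (A : 'M[F]_#|V|) :
    set_system V :=
  [set X : {set V} | principal_submx A X \in unitmx].

Definition skew_symmetric (F : fieldType) (n : nat) (A : 'M[F]_n) : Prop :=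
  A^T = - A.

Definition representable (F : fieldType) (V : finType) (M : set_system V) :
    Prop :=
  delta_matroid M /\
  exists (A : 'M[F]_#|V|) (X : {set V}),
    skew_symmetric A /\ M = pivot X (matrix_system A).

Definition binary (V : finType) (M : set_system V) : Prop :=
  representable 'F_2 M.

Definition vf_closed (P : forall V : finType, set_system V -> Prop) : Prop :=
  forall (V : finType) (M : set_system V), P V M ->
  forall (v : V) (rho : set_system V -> set_system V),
    invertible_vertex_flip v rho -> P V (rho M).

(* phi lists the flips in order of application: M phi is the left fold. *)
Definition vf_safe (V : finType) (M : set_system V) : Prop :=
  forall phi : seq (set_system V -> set_system V),
    List.Forall (fun rho => exists v : V, invertible_vertex_flip v rho) phi ->
    delta_matroid (foldl (fun N rho => rho N) M phi).

(* Main.v *)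
Require Import Defs.
From mathcomp Require Import all_boot all_algebra.

(** A pair [P, Q] of square matrices with rows indexed by [V] encodes the set
    system [M] of those [X] for which replacing the rows of [P] in [X] by the
    rows of [Q] gives a nonsingular matrix.  The pair is Lagrangian when
    [P^T Q + Q^T P = 0].  [M_A] is encoded by [1, A], pivoting exchanges rows of
    [P] and [Q], and over [F_2] loop complementation on [v] adds row [v] of [P]
    to row [v] of [Q], because the determinant is additive in that row and a sum
    in [F_2] is nonzero iff exactly one summand is; these operations keep the
    pair Lagrangian.  Conversely, if [M] is nonempty, a pivot makes [P]
    invertible, and then [Q P^-1] is a skew-symmetric matrix that represents the
    pivoted system. *)

Set Implicit Arguments.
Unset Strict Implicit.
Unset Printing Implicit Defensive.

Import GRing.Theory.
Local Open Scope ring_scope.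

(** * Symmetric differences, pivots and loop complements of set systems *)

Lemma in_symdiff (T : finType) (A B : {set T}) x :
  (x \in symdiff A B) = (x \in A) (+) (x \in B).
Proof. by rewrite !inE; case: (x \in A); case: (x \in B). Qed.

Lemma symdiffK (T : finType) (A : {set T}) :
  involutive (fun B => symdiff B A).
Proof. by move=> B; apply/setP=> x; rewrite !in_symdiff addbK. Qed.

Lemma symdiffA (T : finType) : associative (@symdiff T).
Proof. by move=> A B C; apply/setP=> x; rewrite !in_symdiff addbA. Qed.

Lemma symdiffC (T : finType) : commutative (@symdiff T).
Proof. by move=> A B; apply/setP=> x; rewrite !in_symdiff addbC. Qed.

Lemma symdiff0 (T : finType) (A : {set T}) : symdiff set0 A = A.
Proof. by apply/setP=> x; rewrite in_symdiff inE. Qed.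

Lemma symdiffv (T : finType) (A : {set T}) : symdiff A A = set0.
Proof. by apply/setP=> x; rewrite in_symdiff inE addbb. Qed.

Lemma in_pivot (V : finType) (X Y : {set V}) (M : set_system V) :
  (Y \in pivot X M) = (symdiff Y X \in M).
Proof.
apply/imsetP/idP => [[Z ZM ->]|YM]; first by rewrite symdiffK.
by exists (symdiff Y X); rewrite ?symdiffK.
Qed.

Lemma pivotK (V : finType) (X : {set V}) : involutive (pivot X).
Proof. by move=> M; apply/setP=> Y; rewrite !in_pivot symdiffK. Qed.

Lemma in_loop_compl (V : finType) (v : V) (M : set_system V) (X : {set V}) :
  (X \in loop_compl v M) =
    (X \in M) (+) ((v \in X) && (X :\ v \in M)).
Proof.
rewrite in_symdiff; congr (_ (+) _).
apply/imsetP/andP => [[Z]|[vX XM]].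
  by rewrite inE => /andP[ZM vZ] ->; rewrite setU11 setU1K.
by exists (X :\ v); rewrite ?setD1K // inE XM !inE eqxx.
Qed.

(** Take [X] in [M]. If [X :\ v] is in [M] it survives, since it avoids [v]; otherwise nothing
    cancels [X]. *)
Lemma proper_loop_compl (V : finType) (v : V) (M : set_system V) :
  proper_system M -> proper_system (loop_compl v M).
Proof.
move=> /set0Pn[X XM]; apply/set0Pn.
have [XvM|XvM] := boolP (X :\ v \in M).
  by exists (X :\ v); rewrite in_loop_compl XvM !inE eqxx.
by exists X; rewrite in_loop_compl XM (negbTE XvM) andbF.
Qed.

(** * Lagrangian pairs over an arbitrary field *)

Section Encoding.

Variables (F : fieldType) (V : finType).
Implicit Types (A P Q : 'M[F]_#|V|) (X Y : {set V}).

Definition mix_rows X P Q : 'M[F]_#|V| :=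
  \matrix_(i, j) if enum_val i \in X then Q i j else P i j.

Definition pair_system P Q : set_system V :=
  [set X | mix_rows X P Q \in unitmx].

(** The columns of [P] stacked on [Q] span a totally isotropic space for the form sending [(x, y)]
    and [(x', y')] to [x^T y' + y^T x']. *)
Definition lagrangian P Q : Prop := P^T *m Q + Q^T *m P = 0.

Lemma unitmx_kerP n (B : 'M[F]_n) :
  reflect (forall z : 'cV_n, B *m z = 0 -> z = 0) (B \in unitmx).
Proof.
apply: (iffP idP) => [uB z Bz|kerB].
  by rewrite -(mulKmx uB z) Bz mulmx0.
rewrite -unitmx_tr unitmxE unitfE; apply/det0P => -[z /negP z0 zB]; apply: z0.
rewrite -(inj_eq trmx_inj) trmx0; apply/eqP/kerB.
by rewrite -[B]trmxK -trmx_mul zB trmx0.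
Qed.

Lemma mix_rows_mulmx X P Q n (B : 'M[F]_(#|V|, n)) i j :
  (mix_rows X P Q *m B) i j =
    if enum_val i \in X then (Q *m B) i j else (P *m B) i j.
Proof.
by rewrite !mxE; case: ifP => h; apply: eq_bigr => k _; rewrite mxE h.
Qed.

Lemma sum_enum_rank X (f : 'I_#|V| -> F) :
  (forall v, v \notin X -> f (enum_rank v) = 0) ->
  \sum_i f i = \sum_(v in X) f (enum_rank v).
Proof.
move=> f0; rewrite (reindex _ (onW_bij _ (@enum_rank_bij V))) /=.
by rewrite (bigID (mem X)) /= [X in _ + X]big1 ?addr0.
Qed.

(* Kernel vectors of [mix_rows X 1%:M A] vanish outside [X]; their restrictions
   to [X] are exactly the kernel vectors of [A[X]]. *)
Lemma matrix_systemE A : matrix_system A = pair_system 1%:M A.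
Proof.
apply/setP=> X; rewrite !inE; apply/unitmx_kerP/unitmx_kerP => kerA z.
  move=> /matrixP Az0.
  have z0 (v : V) : v \notin X -> z (enum_rank v) 0 = 0.
    move=> vX; have := Az0 (enum_rank v) 0.
    by rewrite mix_rows_mulmx enum_rankK (negbTE vX) mul1mx mxE.
  pose y : 'cV[F]_#|X| := \col_k z (enum_rank (enum_val k)) 0.
  have y0 : y = 0.
    apply: kerA; apply/matrixP=> i j; rewrite ord1 [RHS]mxE.
    have := Az0 (enum_rank (enum_val i)) 0.
    rewrite mix_rows_mulmx enum_rankK enum_valP !mxE (sum_enum_rank (X := X)).
      by rewrite big_enum_val => Azi; rewrite -[RHS]Azi; apply: eq_bigr => k _;
        rewrite !mxE.
    by move=> v vX; rewrite z0 ?mulr0.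
  apply/matrixP=> i j; rewrite ord1 mxE -[i]enum_valK.
  have [vX|] := boolP (enum_val i \in X); last exact: z0.
  rewrite -(enum_rankK_in vX vX).
  by move/matrixP: y0 => /(_ (enum_rank_in vX (enum_val i)) 0); rewrite !mxE.
move=> /matrixP Az0.
(* The extension of [z] by zero: by injectivity of [enum_rank] and [enum_val], each sum has at most
   one term. *)
pose y : 'cV[F]_#|V| :=
  \col_i \sum_(k | enum_rank (enum_val k) == i) z k 0.
have yE k : y (enum_rank (enum_val k)) 0 = z k 0.
  rewrite mxE (big_pred1 k) // => l /=.
  by rewrite (inj_eq enum_rank_inj) (inj_eq enum_val_inj).
have yX v : v \notin X -> y (enum_rank v) 0 = 0.
  move=> vX; rewrite mxE big1 // => k /eqP /enum_rank_inj kv.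
  by rewrite -kv enum_valP in vX.
have y0 : y = 0.
  apply: kerA; apply/matrixP=> i j; rewrite ord1 mix_rows_mulmx mul1mx [RHS]mxE.
  case: ifPn => [vX|/yX]; last by rewrite enum_valK.
  rewrite mxE (sum_enum_rank (X := X)); last first.
    by move=> v vX'; rewrite yX ?mulr0.
  have := Az0 (enum_rank_in vX (enum_val i)) 0; rewrite !mxE => Azi.
  rewrite big_enum_val -[RHS]Azi.
  by apply: eq_bigr => k _; rewrite yE !mxE enum_rankK_in ?enum_valK.
by apply/matrixP=> i j; rewrite ord1 -yE y0 !mxE.
Qed.

Lemma lagrangian1 A : lagrangian 1%:M A <-> skew_symmetric A.
Proof.
rewrite /lagrangian /skew_symmetric trmx1 mul1mx mulmx1 addrC.
by split=> [/eqP|->]; [rewrite addr_eq0 => /eqP | rewrite addNr].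
Qed.

Lemma pivot_pair_system Y P Q :
  pivot Y (pair_system P Q) =
    pair_system (mix_rows Y P Q) (mix_rows Y Q P).
Proof.
apply/setP=> X; rewrite in_pivot !inE; congr (_ \in unitmx).
apply/matrixP=> i j; rewrite !mxE in_symdiff.
by case: (_ \in X); case: (_ \in Y).
Qed.

(** Row [i] contributes [P i j * Q i k + Q i j * P i k] to entry [(j, k)], which is symmetric in [P]
    and [Q]. *)
Lemma lagrangian_mix_rows Y P Q :
  lagrangian P Q -> lagrangian (mix_rows Y P Q) (mix_rows Y Q P).
Proof.
rewrite /lagrangian => <-; apply/matrixP=> j k; rewrite !mxE -!big_split /=.
apply: eq_bigr => i _; rewrite !mxE; case: ifP => // _.
by rewrite addrC.
Qed.

Lemma mix_rows0 P Q : mix_rows set0 P Q = P.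
Proof. by apply/matrixP=> i j; rewrite mxE inE. Qed.

Lemma pair_system_unit P Q : P \in unitmx ->
  pair_system P Q = matrix_system (Q *m invmx P).
Proof.
move=> uP; rewrite matrix_systemE; apply/setP=> X; rewrite !inE.
have -> : mix_rows X P Q = mix_rows X 1%:M (Q *m invmx P) *m P.
  apply/matrixP=> i j; rewrite mix_rows_mulmx mulmxKV // mul1mx mxE.
  by case: ifP.
by rewrite unitmx_mul uP andbT.
Qed.

Lemma lagrangian_unit P Q : P \in unitmx -> lagrangian P Q ->
  skew_symmetric (Q *m invmx P).
Proof.
move=> uP /eqP; rewrite addr_eq0 => /eqP PQ.
have uPT : P^T \in unitmx by rewrite unitmx_tr.
(* Multiplying by [P^T] on the left and [P] on the right reduces the claim to [Q^T P = - P^T Q]. *)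
apply: (can_inj (mulKmx uPT)); apply: (can_inj (mulmxK uP)).
rewrite trmx_mul trmx_inv mulKVmx // mulmxN mulNmx.
by rewrite mulmxA mulmxKV // PQ opprK.
Qed.

Lemma pair_system_pivot P Q X : lagrangian P Q -> X \in pair_system P Q ->
  exists2 A : 'M[F]_#|V|, skew_symmetric A &
    pair_system P Q = pivot X (matrix_system A).
Proof.
move=> lPQ; rewrite inE => uX.
exists (mix_rows X Q P *m invmx (mix_rows X P Q)).
  exact/lagrangian_unit/lagrangian_mix_rows.
by rewrite -pair_system_unit // -pivot_pair_system pivotK.
Qed.

(* If [A u u = 0], row [u] of the nonsingular [A[Y]] has a nonzero entry
   [a = A u w], and then [A[{u, w}] = [[0, a], [-a, *]]] is nonsingular. *)
Lemma matrix_system_exchange0 A Y u : skew_symmetric A ->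
  Y \in matrix_system A -> u \in Y ->
  [set u] \in matrix_system A \/
  exists w : V, [/\ w \in Y, w != u & [set u; w] \in matrix_system A].
Proof.
move=> skA; rewrite !matrix_systemE => YM uY.
pose a x y := A (enum_rank x) (enum_rank y).
have aC x y : a x y = - a y x.
  by move/matrixP: skA => /(_ (enum_rank y) (enum_rank x)); rewrite !mxE.
have row_sum (X : {set V}) (z : 'cV[F]_#|V|) : mix_rows X 1%:M A *m z = 0 ->
    (forall x, x \notin X -> z (enum_rank x) 0 = 0) /\
    (forall x, x \in X -> \sum_(y in X) a x y * z (enum_rank y) 0 = 0).
  move=> /matrixP Xz.
  have z0 x : x \notin X -> z (enum_rank x) 0 = 0.
    move=> xX; have := Xz (enum_rank x) 0.
    by rewrite mix_rows_mulmx enum_rankK (negbTE xX) mul1mx mxE.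
  split=> // x xX; have := Xz (enum_rank x) 0.
  rewrite mix_rows_mulmx enum_rankK xX !mxE (sum_enum_rank (X := X)) //.
  by move=> y yX; rewrite z0 ?mulr0.
have [auu|auu] := eqVneq (a u u) 0; last first.
  left; rewrite inE; apply/unitmx_kerP=> z /row_sum[z0 /(_ u (set11 u))].
  rewrite big_set1 => /eqP; rewrite mulf_eq0 (negbTE auu) /= => /eqP zu.
  apply/matrixP=> i j; rewrite ord1 mxE -[i]enum_valK.
  by have [->//|iu] := eqVneq (enum_val i) u; apply: z0; rewrite inE.
right.
have [w /andP[wY auw]] : exists w, (w \in Y) && (a u w != 0).
  (* If row [u] vanished on [Y], skew symmetry would make column [u] vanish there too, and the unit
     vector at [u] would lie in the kernel. *)
  apply/existsP; apply: contraLR YM => /existsPn a0.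
  rewrite inE; apply/unitmx_kerP=> kerA.
  have /kerA /matrixP/(_ (enum_rank u) 0) :
      mix_rows Y 1%:M A *m delta_mx (enum_rank u) (0 : 'I_1) = 0.
    apply/matrixP=> i j; rewrite ord1 mix_rows_mulmx mul1mx -colE.
    rewrite !mxE -[i]enum_valK enum_rankK; case: ifP => [vY|/negbT vY].
      apply/eqP; rewrite -/(a (enum_val i) u) aC oppr_eq0.
      by have := a0 (enum_val i); rewrite vY /= negbK.
    by rewrite (inj_eq enum_rank_inj) (negbTE (memPnC vY u uY)) // andbF.
  by rewrite !mxE !eqxx => /eqP; rewrite oner_eq0.
have wu : w != u by apply: contraNneq auw => ->; rewrite auu.
exists w; split=> //; rewrite inE; apply/unitmx_kerP=> z /row_sum[z0 az].
have sum2 (f : V -> F) : \sum_(y in [set u; w]) f y = f u + f w.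
  by rewrite big_setU1 ?big_set1 // inE eq_sym.
have zw : z (enum_rank w) 0 = 0.
  have /eqP := az u (set21 u w).
  by rewrite sum2 auu mul0r add0r mulf_eq0 (negbTE auw) /= => /eqP.
have zu : z (enum_rank u) 0 = 0.
  have /eqP := az w (set22 u w).
  by rewrite sum2 zw mulr0 addr0 aC mulf_eq0 oppr_eq0 (negbTE auw) /= => /eqP.
apply/matrixP=> i j; rewrite ord1 mxE -[i]enum_valK.
have [->//|iu] := eqVneq (enum_val i) u.
have [->//|iw] := eqVneq (enum_val i) w.
by apply: z0; rewrite !inE negb_or iu.
Qed.

(** Pivoting on [X] moves [X] to the empty set and [Y] to [symdiff X Y], so only exchange from the
    empty set in a [matrix_system] is needed. *)
Lemma pair_system_exchange P Q :
  lagrangian P Q -> symmetric_exchange (pair_system P Q).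
Proof.
move=> lPQ X Y XM YM u uXY.
pose P' := mix_rows X P Q; pose Q' := mix_rows X Q P.
have lPQ' : lagrangian P' Q' by exact: lagrangian_mix_rows.
have uP' : P' \in unitmx by rewrite inE in XM.
have memE Z : (symdiff X Z \in pair_system P Q) =
    (Z \in matrix_system (Q' *m invmx P')).
  by rewrite -pair_system_unit // -pivot_pair_system in_pivot symdiffC.
have YM' : symdiff X Y \in matrix_system (Q' *m invmx P').
  by rewrite -memE symdiffA symdiffv symdiff0.
have [uM|[w [wXY wu uwM]]] :=
    matrix_system_exchange0 (lagrangian_unit uP' lPQ') YM' uXY.
  by left; rewrite memE.
by right; exists w; split=> //; rewrite memE.
Qed.

(** Closure under an operation can thus be checked on pairs; properness supplies a set to pivot on
    when returning to a matrix. *)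
Lemma representableP (M : set_system V) :
  representable F M <->
  proper_system M /\ exists P Q, lagrangian P Q /\ M = pair_system P Q.
Proof.
split=> [[[properM _] [A [X [skA ME]]]]|[properM [P [Q [lPQ ME]]]]].
  split=> //; exists (mix_rows X 1%:M A), (mix_rows X A 1%:M); split.
    by apply: lagrangian_mix_rows; apply/lagrangian1.
  by rewrite ME -pivot_pair_system matrix_systemE.
split; first by split=> //; rewrite ME; exact: pair_system_exchange.
have /set0Pn[X] := properM; rewrite ME => /(pair_system_pivot lPQ)[A skA ->].
by exists A, X.
Qed.

Lemma representable_pivot Y (M : set_system V) :
  representable F M -> representable F (pivot Y M).
Proof.
move=> /representableP[properM [P [Q [lPQ ME]]]]; apply/representableP; split.
  have /set0Pn[X XM] := properM; apply/set0Pn; exists (symdiff X Y).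
  by rewrite in_pivot symdiffK.
exists (mix_rows Y P Q), (mix_rows Y Q P).
by rewrite ME pivot_pair_system; split=> //; exact: lagrangian_mix_rows.
Qed.

End Encoding.

(** * Loop complementation over the two-element field *)

Section LoopComplementation.

(* Equivalent to [F] having two elements; unification is very slow at ['F_2]. *)
Variable F : fieldType.
Hypothesis neq0D : forall x y : F, (x + y != 0) = (x != 0) (+) (y != 0).
Variables (V : finType) (v : V).
Implicit Types P Q : 'M[F]_#|V|.

Lemma addrr_eq0 (x : F) : x + x = 0.
Proof. by apply/eqP; have := neq0D x x; rewrite addbb => /negbFE. Qed.

Definition add_row P Q : 'M[F]_#|V| :=
  \matrix_(i, j) if i == enum_rank v then Q i j + P i j else Q i j.

Lemma loop_compl_pair_system P Q :
  loop_compl v (pair_system P Q) = pair_system P (add_row P Q).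
Proof.
apply/setP=> X; rewrite in_loop_compl !inE !unitmxE !unitfE.
have rE i : (enum_val i == v) = (i == enum_rank v).
  by rewrite -(inj_eq enum_rank_inj) enum_valK.
(* For [v] outside [X], row [v] is taken from [P], so the change to row [v] of [Q] is not seen. *)
have [vX|vX] /= := boolP (v \in X); last first.
  rewrite addbF; congr (\det _ != 0); apply/matrixP=> i j; rewrite !mxE.
  by case: eqP => // ->; rewrite enum_rankK (negbTE vX).
(* The determinant is split along row [v]: the summand from [Q] gives the matrix for [X], the one
   from [P] that for [X :\ v]. *)
rewrite -neq0D; congr (_ != 0); symmetry.
rewrite -[X in _ = X + _]mul1r -[X in _ = _ + X]mul1r.
apply: (@determinant_multilinear _ _ _ _ _ (enum_rank v)).
- by apply/rowP=> j; rewrite !mxE !inE enum_rankK vX !eqxx /= !mul1r.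
- apply/matrixP=> i j; rewrite !mxE.
  by rewrite eq_sym (negbTE (neq_lift _ _)).
- apply/matrixP=> i j; rewrite !mxE !inE rE.
  by rewrite eq_sym (negbTE (neq_lift _ _)).
Qed.

(** The terms added by row [v] are two copies of [P i j * P i k], which cancel in characteristic
    2. *)
Lemma lagrangian_add_row P Q : lagrangian P Q -> lagrangian P (add_row P Q).
Proof.
rewrite /lagrangian => <-; apply/matrixP=> j k; rewrite !mxE -!big_split /=.
apply: eq_bigr => i _; rewrite !mxE; case: ifP => // _.
rewrite mulrDr mulrDl [P i j * P i k]mulrC addrACA.
by rewrite [P i k * P i j]mulrC addrr_eq0 addr0.
Qed.

Lemma representable_loop_compl (M : set_system V) :
  representable F M -> representable F (loop_compl v M).
Proof.
move=> /representableP[properM [P [Q [lPQ ME]]]]; apply/representableP.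
split; first exact: proper_loop_compl.
exists P, (add_row P Q); rewrite ME loop_compl_pair_system.
by split=> //; exact: lagrangian_add_row.
Qed.

End LoopComplementation.

(** * Closure of binary delta-matroids under vertex flips *)

Lemma F2_neq0D (x y : 'F_2) : (x + y != 0) = (x != 0) (+) (y != 0).
Proof. by case: x y => [[|[|//]] ?] [[|[|//]] ?]. Qed.

Lemma binary_flip (V : finType) (M : set_system V) (v : V)
    (rho : set_system V -> set_system V) :
  binary M -> invertible_vertex_flip v rho -> binary (rho M).
Proof.
move=> binM; elim=> {rho} // rho _; first exact: representable_pivot.
exact: (representable_loop_compl F2_neq0D).
Qed.

Theorem theorem8p2 :
  vf_closed (@binary) /\
  (forall (V : finType) (M : set_system V), binary M -> vf_safe M).
Proof.
split=> [V M binM v rho|V M binM phi]; first exact: binary_flip.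
(* The induction must carry [binary], since being a delta-matroid alone need not survive a flip. *)
move=> flips; suff [] : binary (foldl (fun N rho => rho N) M phi) by [].
elim: flips M binM => [|rho phi' [v rhoP] _ IH] M binM //=.
exact/IH/(binary_flip binM rhoP).
Qed.
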